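(* Let $\lambda$ be a nonzero real number, $r\geq 0$ an integer and $z\in\mathbb{C}$. Then for every integer $n\geq0$, $$\phi_{n+1,\lambda}^{(r)}(|z|^2)=\sum_{k=0}^n\binom{n}{k}\phi_{k,\lambda}^{(r)}(|z|^2)\Big(|z|^2(1-\lambda)_{n-k,\lambda}+r(-\lambda)_{n-k,\lambda}\Big).$$
   Context: Degenerate falling factorials: $(x)_{0,\lambda}=1$, $(x)_{k,\lambda}=x(x-\lambda)\cdots(x-(k-1)\lambda)$ for $k\ge1$; ordinary falling factorials $(x)_0=1$, $(x)_k=x(x-1)\cdots(x-k+1)$. Degenerate $r$-Stirling numbers of the second kind are defined by $(x+r)_{n,\lambda}=\sum_{k=0}^n \begin{Bmatrix}n+r \\ k+r \end{Bmatrix}_{r,\lambda}(x)_k$ ($n\ge0$), and the degenerate $r$-Bell polynomials by $\phi_{n,\lambda}^{(r)}(x)=\sum_{k=0}^n \begin{Bmatrix}n+r \\ k+r \end{Bmatrix}_{r,\lambda}x^k$; equivalently $e_\lambda^r(t)e^{x(e_\lambda(t)-1)}=\sum_{n\ge0}\phi_{n,\lambda}^{(r)}(x)\frac{t^n}{n!}$, where $e_\lambda^x(t)=(1+\lambda t)^{x/\lambda}=\sum_{k\ge0}(x)_{k,\lambda}\frac{t^k}{k!}$ and $e_\lambda(t)=e_\lambda^1(t)$. *)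

(* Defs.v *)
From mathcomp Require Import all_boot all_order all_algebra.
From mathcomp Require Import boolp reals.
From mathcomp Require Import complex.
From mathcomp Require Import ring.

Set Implicit Arguments.
Unset Strict Implicit.
Unset Printing Implicit Defensive.

Import Order.TTheory GRing.Theory Num.Theory.
Local Open Scope ring_scope.

(* (x)_{k,lambda} = x (x - lambda) ... (x - (k-1) lambda) *)
Definition dffact (R : realType) (lambda x : R) (k : nat) : R :=
  \prod_(i < k) (x - i%:R * lambda).

(* (x)_k = x (x - 1) ... (x - k + 1), for a real x (ssrnat's falling factorial
   is restricted to natural numbers) *)
Definition rffact (R : realType) (x : R) (k : nat) : R :=
  \prod_(i < k) (x - i%:R).

(* [S k] is the coefficient of (x)_k in the expansion of (x + r)_{n,lambda};
   the numbers are set to 0 for k > n, so that S is determined. *)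
Definition is_drstirling2 (R : realType) (lambda : R) (r n : nat)
    (S : nat -> R) : Prop :=
  (forall x : R,
     dffact lambda (x + r%:R) n = \sum_(k < n.+1) S k * rffact x k) /\
  (forall k : nat, (n < k)%N -> S k = 0).

Lemma is_drstirling2_exists (R : realType) (lambda : R) (r n : nat) :
  exists S : nat -> R, is_drstirling2 lambda r n S.
Proof.
elim: n => [|n [S [HS S0]]].
  exists (fun k => (k == 0%N)%:R); split=> [x|[]//].
  by rewrite big_ord1 /dffact /rffact !big_ord0 mulr1.
exists (fun k => (if k is j.+1 then S j else 0)
                 + (k%:R + r%:R - n%:R * lambda) * S k); split=> [x|[//|k] lt_nk].
  rewrite /dffact big_ord_recr /= -/(dffact _ _ _) HS mulr_suml.
  under [RHS]eq_bigr do rewrite mulrDl.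
  rewrite big_split /= [X in _ = X + _]big_ord_recl /= mul0r add0r.
  rewrite [X in _ = _ + X]big_ord_recr /= (S0 n.+1) // mulr0 mul0r addr0.
  rewrite -big_split /=; apply: eq_bigr => i _.
  rewrite /rffact big_ord_recr /=; ring.
by rewrite !S0 ?addr0 ?mulr0 ?addr0 // ltnW.
Qed.

Lemma is_drstirling2_uniq (R : realType) (lambda : R) (r n : nat)
    (S T : nat -> R) :
  is_drstirling2 lambda r n S -> is_drstirling2 lambda r n T -> S =1 T.
Proof.
move=> [HS S0] [HT T0] k; elim/ltn_ind: k => k IHk.
have [lt_nk|le_kn] := ltnP n k; first by rewrite S0 ?T0.
have rf0 m : (k < m)%N -> rffact k%:R m = 0 :> R.
  by move=> lt_km; rewrite /rffact (bigD1 (Ordinal lt_km)) //= subrr mul0r.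
have rfk : rffact k%:R k != 0 :> R.
  by apply/prodf_neq0 => i _; rewrite subr_eq0 eqr_nat gtn_eqF.
have lt_kn1 : (k < n.+1)%N by [].
have := HS k%:R; rewrite HT (bigD1 (Ordinal lt_kn1)) //=.
rewrite [RHS](bigD1 (Ordinal lt_kn1)) //= => /esym.
rewrite (eq_bigr (fun i : 'I_n.+1 => T i * rffact k%:R i)) => [|i /eqP neq_ik].
  by move/addIr/(mulIf rfk).
case: (ltngtP i k) => [lt_ik|lt_ki|eq_ik]; first by rewrite IHk.
  by rewrite rf0 ?mulr0.
by case: neq_ik; apply: val_inj.
Qed.

(* [drstirling2 lambda r n k] is the degenerate r-Stirling number of the second
   kind written with the shifted arguments n + r over k + r. *)
Definition drstirling2 (R : realType) (lambda : R) (r n : nat) : nat -> R :=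
  sval (cid (is_drstirling2_exists lambda r n)).

Lemma drstirling2P (R : realType) (lambda : R) (r n : nat) :
  is_drstirling2 lambda r n (drstirling2 lambda r n).
Proof. exact: svalP. Qed.

Definition drbell (R : realType) (lambda : R) (r n : nat) : {poly R} :=
  \sum_(k < n.+1) drstirling2 lambda r n k *: 'X^k.

(* Main.v *)
(** The operator [A q = 'X q + 'X q^`()] satisfies [(A - k) 'X^k = 'X^(k+1)], so
    [p(A) 1] is the image of the polynomial [p] under the linear map sending
    [(x)_k] to ['X^k].  Hence the degenerate r-Bell polynomials are
    [(A + r)_{n,lambda} 1].  Pulling out the first factor [A + r], with
    [A 1 = 'X] and [A 'X = 'X (A + 1)], gives
    [r (A + r - lambda)_{n,lambda} 1 + 'X (A + r + 1 - lambda)_{n,lambda} 1],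
    and the theorem follows from Vandermonde's identity
    [(A + s + b)_{n,lambda} =
       \sum_k 'C(n, k) (A + s)_{k,lambda} (b)_{n-k,lambda}]. *)
Require Import Defs.
From mathcomp Require Import all_boot all_order all_algebra.
From mathcomp Require Import reals complex.
From mathcomp Require Import ring.

Import Order.TTheory GRing.Theory Num.Theory.
Local Open Scope ring_scope.

(* [(A + s)_{n,lambda} 1] for the operator [A] above. *)
Fixpoint bell_shift {R : realType} (lambda s : R) (n : nat) : {poly R} :=
  if n is m.+1 then
    (s - m%:R * lambda) *: bell_shift lambda s m
    + 'X * bell_shift lambda s m + 'X * (bell_shift lambda s m)^`()
  else 1.

Lemma dffactS (R : realType) (lambda x : R) (n : nat) :
  dffact lambda x n.+1 = dffact lambda x n * (x - n%:R * lambda).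
Proof. by rewrite /dffact big_ord_recr. Qed.

Lemma rffactS (R : realType) (x : R) (n : nat) :
  rffact x n.+1 = rffact x n * (x - n%:R).
Proof. by rewrite /rffact big_ord_recr. Qed.

(** Both sides follow the recurrence that [(x)_k (x - k) = (x)_{k+1}] yields. *)
Lemma bell_shift_drstirling2 (R : realType) (lambda : R) (r n : nat) :
  is_drstirling2 lambda r n (fun k => (bell_shift lambda r%:R n)`_k).
Proof.
elim: n => [|n [IHsum IHdeg]].
  split=> [x|[//|k] _]; last by rewrite coef1.
  by rewrite big_ord1 /dffact /rffact !big_ord0 coef1 mulr1.
have coefS k : (bell_shift lambda r%:R n.+1)`_k =
    (if k is j.+1 then (bell_shift lambda r%:R n)`_j else 0)
    + (k%:R + r%:R - n%:R * lambda) * (bell_shift lambda r%:R n)`_k.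
  rewrite /= !coefD coefZ !coefXM; case: k => [|k] /=; first by ring.
  by rewrite coef_deriv -mulr_natl; ring.
split=> [x|k lt_nk].
  rewrite dffactS IHsum mulr_suml.
  under [RHS]eq_bigr do rewrite coefS mulrDl.
  rewrite big_split /= [X in _ = X + _]big_ord_recl /= mul0r add0r.
  rewrite [X in _ = _ + X]big_ord_recr /= (IHdeg n.+1) // mulr0 mul0r addr0.
  rewrite -big_split /=; apply: eq_bigr => i _.
  by rewrite rffactS; ring.
case: k lt_nk => // k lt_nk.
by rewrite coefS !IHdeg ?mulr0 ?addr0 // ltnW.
Qed.

Lemma drbellE (R : realType) (lambda : R) (r n : nat) :
  drbell lambda r n = bell_shift lambda r%:R n.
Proof.
have [_ deg_le_n] := bell_shift_drstirling2 _ lambda r n.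
rewrite /drbell -poly_def; apply/polyP => k; rewrite coef_poly ltnS.
case: leqP => [_|/deg_le_n //].
exact: is_drstirling2_uniq (drstirling2P lambda r n)
  (bell_shift_drstirling2 _ _ _ _) k.
Qed.

(** The definition peels off the last factor, this the first; the product rule on ['X * q] supplies
    the shift by 1. *)
Lemma bell_shiftSl (R : realType) (lambda s : R) (n : nat) :
  bell_shift lambda s n.+1 =
  s *: bell_shift lambda (s - lambda) n
  + 'X * bell_shift lambda (s + 1 - lambda) n.
Proof.
elim: n => [|n IHn]; first by rewrite /= derivC mul0r subr0 mulr0 addr0.
rewrite [LHS]/= -/(bell_shift lambda s n.+1) IHn /=.
rewrite derivD derivZ derivM derivX -!mul_polyC -!natr1.
rewrite !(polyCD, polyCN, polyCM); ring.
Qed.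

Lemma bell_shiftD (R : realType) (lambda s b : R) (n : nat) :
  bell_shift lambda (s + b) n =
  \sum_(k < n.+1)
     ('C(n, k)%:R * dffact lambda b (n - k)) *: bell_shift lambda s k.
Proof.
elim: n => [|n IHn].
  by rewrite big_ord1 bin0 /dffact big_ord0 mulr1 scale1r.
rewrite [LHS]/= IHn (raddf_sum deriv) scaler_sumr !mulr_sumr -!big_split /=.
(* The new factor splits as [(A + s - k lambda) + (b - (n - k) lambda)], giving [F] and [G]. *)
pose F k := ('C(n, k)%:R * dffact lambda b (n - k)) *:
  bell_shift lambda s k.+1.
pose G k := ('C(n, k)%:R * dffact lambda b (n.+1 - k)) *: bell_shift lambda s k.
rewrite (eq_bigr (fun k : 'I_n.+1 => F k + G k)); last first.
  move=> k _; rewrite /F /G subSn ?leq_ord // dffactS natrB ?leq_ord //=.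
  rewrite derivZ -!mul_polyC !(polyCD, polyCN, polyCM, polyCB); ring.
rewrite [RHS]big_ord_recl /= [RHS](_ : _ = G 0%N + \sum_(k < n.+1) (F k + G k.+1)).
  (* This zero term lets the sum of [G] shift by one, ready for Pascal's rule. *)
  have G0 : G n.+1 = 0 by rewrite /G bin_small // mul0r scale0r.
  have : \sum_(k < n.+2) G k = G 0%N + \sum_(k < n.+1) G k.+1.
    exact: big_ord_recl.
  by rewrite big_ord_recr /= G0 addr0 !big_split /= addrCA => ->.
congr (_ + _); first by rewrite /G !bin0.
apply: eq_bigr => k _; rewrite /F /G /= binS natrD subSS.
by rewrite mulrDl scalerDl addrC.
Qed.

(* [ComplexField.Normc.normc z : R] is the modulus |z| as a real number. *)
Theorem theorem6 (R : realType) (lambda : R) (lambda_neq0 : lambda != 0)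
    (r : nat) (z : R[i]) (n : nat) :
  let x : R := ComplexField.Normc.normc z ^+ 2 in
  (drbell lambda r n.+1).[x] =
  \sum_(k < n.+1) 'C(n, k)%:R * (drbell lambda r k).[x] *
     (x * dffact lambda (1 - lambda) (n - k)
      + r%:R * dffact lambda (- lambda) (n - k)).
Proof.
(* Both shifts are expanded around [s = r], with [b = - lambda] and [b = 1 - lambda]. *)
move=> x; rewrite drbellE bell_shiftSl -addrA !bell_shiftD.
rewrite hornerD hornerZ hornerM hornerX !horner_sum !mulr_sumr -big_split /=.
by apply: eq_bigr => k _; rewrite drbellE !hornerZ; ring.
Qed.
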